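(* Let $p\in(1,\infty)$, $d\ge2$, and let $\mathcal H=\Delta_p+V$ be a positive $p$-Schrödinger operator with $V\le1$ on a $d$-regular tree $\mathbb T_d$ (with standard weights and $m=1$). Let $\beta\in(0,1)$ satisfy $$(1-\beta)^{p-1}=\frac1d\Big(\frac1\beta-1\Big)^{p-1}-\frac1d.$$ Let $u$ be an $\mathcal H$-harmonic function such that $$|u|\in O\big(d^{-|x|/p}\big),$$ $$|\nabla_{xy}u_+|\ \begin{cases}\lesssim d^{-|x|/p}&\text{if }p\ge2,\\ \gtrsim d^{-|x|/p}&\text{if }p<2,\end{cases}\qquad\text{for }x\sim y,$$ and in addition $$\liminf_{x\to\infty}\frac{|u(x)|}{\beta^{|x|}}=0.$$ Then $u=0$.
   Context: $X=\mathbb T_d$ is the countably infinite vertex set of a tree with a fixed vertex $o$; $|x|=d(x,o)$ is the combinatorial graph distance to $o$. Standard weights: $b(x,y)=1$ if $x,y$ are at combinatorial distance $1$ (written $x\sim y$) and $b(x,y)=0$ otherwise; $m=1$. The tree is $d$-regular if every vertex $x$ has exactly $d$ neighbors $y$ with $|y|=|x|+1$ and every vertex $x\ne o$ has exactly one neighbor $y$ with $|y|=|x|-1$. $\nabla_{xy}f=f(x)-f(y)$, $u_+=u\vee0$. For $a\in\mathbb R$, $r>0$ let $a^{\langle r\rangle}=a|a|^{r-1}$ if $a\ne0$ and $0^{\langle r\rangle}=0$. For $f:X\to\mathbb R$, $$\Delta_p[f](x)=\sum_{y\sim x}(\nabla_{xy}f)^{\langle p-1\rangle},\qquad\mathcal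 H[f](x)=\Delta_p[f](x)+V(x)f(x)^{\langle p-1\rangle},$$ with potential $V:X\to\mathbb R$. $f$ is $\mathcal H$-superharmonic if $\mathcal H[f]\ge0$ and $\mathcal H$-harmonic if $\mathcal H[f]=0$ on $X$. $\mathcal H$ is positive if it admits an $\mathcal H$-superharmonic function $f\ge0$, $f\ne0$. $f\lesssim g$ means $f\le Cg$ for some constant $C\ge0$ independent of the arguments; $f\gtrsim g$ means $g\lesssim f$; $f\in O(g)$ means $|f|\lesssim g$. $x\to\infty$ means leaving every finite subset of $X$. *)

(* Defs.v *)
From mathcomp Require Import all_boot all_order all_algebra.
From mathcomp Require Import all_classical all_reals all_analysis.
Set Implicit Arguments.
Unset Strict Implicit.
Unset Printing Implicit Defensive.
Import Order.TTheory GRing.Theory Num.Theory.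
Local Open Scope classical_set_scope.
Local Open Scope card_scope.
Local Open Scope ring_scope.

Section Graph.
Variables (X : choiceType) (adj : rel X).

(* [s] lists the vertices visited after [x], so [size s] is the length. *)
Definition walk (x y : X) (s : seq X) : Prop := path adj x s /\ last x s = y.

(* Junk value 0 if no walk joins [x] to [y]. *)
Definition gdist (x y : X) : nat :=
  xget 0%N [set n | (exists s, walk x y s /\ size s = n) /\
                    (forall s, walk x y s -> (n <= size s)%N)].

Definition is_tree : Prop :=
  [/\ symmetric adj, irreflexive adj,
      (forall x y, exists s, walk x y s) &
      (forall c : seq X, ucycle adj c -> (size c <= 2)%N)].

(* The root has degree [d]; every other vertex has degree [d.+1]. *)
Definition is_regular_tree (o : X) (d : nat) : Prop :=
  [/\ [set: X] #= [set: nat], is_tree,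
      (forall x, [set y | adj x y /\ gdist y o = (gdist x o).+1] #= `I_d) &
      (forall x, x <> o ->
         exists! y, adj x y /\ gdist x o = (gdist y o).+1)].

End Graph.

(* The signed power a^<r>. *)
Definition spow (R : realType) (a r : R) : R :=
  if a == 0 then 0 else a * `|a| `^ (r - 1).

Section Operator.
Variables (R : realType) (X : choiceType) (adj : rel X).
Implicit Types (p : R) (V f : X -> R).

Definition grad f (x y : X) : R := f x - f y.

(* The finitely supported sum is the sum over all neighbours when the graph is
   locally finite. *)
Definition plaplacian p f (x : X) : R :=
  \sum_(y \in [set y | adj x y]) spow (grad f x y) (p - 1).

Definition schrodinger p V f (x : X) : R :=
  plaplacian p f x + V x * spow (f x) (p - 1).

Definition schrodinger_superharmonic p V f : Prop :=
  forall x, 0 <= schrodinger p V f x.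

Definition schrodinger_harmonic p V f : Prop :=
  forall x, schrodinger p V f x = 0.

Definition positive_schrodinger p V : Prop :=
  exists f, [/\ schrodinger_superharmonic p V f, (forall x, 0 <= f x) &
                (exists x, f x <> 0)].

End Operator.

(* The liminf as x leaves every finite subset of X. The library's [limf_einf]
   needs a filtered type, a structure [X] does not carry. *)
Definition liminf_infty (R : realType) (X : choiceType) (f : X -> \bar R) :
    \bar R :=
  ereal_sup [set ereal_inf [set f x | x in A] | A in [set A | cofinite_set A]].

(* Main.v *)
(** Let [phi > 0] be [H]-superharmonic, [w = u_+], and [psi_N(x) = (1 - |x|/N)_+].
    Testing [phi] with [(psi_N w)^p / phi^(p-1)] and [w] with [psi_N^p w], the
    potential cancels: summed over edges, the Picone defect of [psi_N w] with
    respect to [phi] is at most its defect with respect to [w]. The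
    first-order term of the latter vanishes, so on an edge at level [n] it is at
    most [d^-n / N] times the modulus of continuity of [t^<p-1>] at [1/N]. There
    are about [d^n] such edges, so the sum over [n <= N] tends to 0. The
    former defect is nonnegative by Picone's inequality and bounded away from 0 on
    any edge where [w] vanishes at exactly one end. Hence [u] is positive
    everywhere as soon as it is positive somewhere, and otherwise the minimum
    principle applies to [-u]. A positive harmonic function dominates
    [u(o) beta^|x|] by the maximum principle, because [V <= 1]; this
    contradicts the liminf condition. *)

Require Import Defs.
From mathcomp Require Import all_boot all_order all_algebra.
From mathcomp Require Import finmap.
From mathcomp Require Import all_classical all_reals all_analysis.
From mathcomp Require Import ring lra zify.
Import Order.TTheory GRing.Theory Num.Theory.
Import numFieldNormedType.Exports.
Local Open Scope classical_set_scope.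
Local Open Scope ring_scope.

Section SignedPower.
Set Implicit Arguments.
Unset Strict Implicit.
Context {R : realType}.
Implicit Types (a b e eta r p s t x y : R).

Lemma spow0 r : spow 0 r = 0.
Proof. by rewrite /spow eqxx. Qed.

Lemma spow_ge0E a r : 0 < r -> 0 <= a -> spow a r = a `^ r.
Proof.
move=> r0 a0; rewrite /spow; case: eqVneq => [->|_].
  by rewrite powR0 ?gt_eqF.
by rewrite ger0_norm// mulr_powRB1.
Qed.

Lemma spowN a r : spow (- a) r = - spow a r.
Proof. by rewrite /spow oppr_eq0 normrN; case: ifP; rewrite ?oppr0// mulNr. Qed.

Lemma normr_spow a r : 0 < r -> `|spow a r| = `|a| `^ r.
Proof.
move=> r0; have [a0|/ltW a0] := leP 0 a.
  by rewrite spow_ge0E// ger0_norm ?powR_ge0// ger0_norm.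
rewrite -[a in LHS]opprK spowN normrN spow_ge0E ?oppr_ge0//.
by rewrite ger0_norm ?powR_ge0// ler0_norm.
Qed.

Lemma ler_spow r a b : 0 < r -> a <= b -> spow a r <= spow b r.
Proof.
move=> r0; have mono x y : 0 <= x -> x <= y -> spow x r <= spow y r.
  move=> x0 xy; have y0 := le_trans x0 xy.
  by rewrite !spow_ge0E// ge0_ler_powR ?nnegrE// ltW.
have [a0 ab|a0 ab] := leP 0 a; first exact: mono.
have [b0|b0] := leP 0 b.
  rewrite -[a]opprK spowN (@le_trans _ _ 0)//.
    by rewrite oppr_le0 -(spow0 r) mono// oppr_ge0 ltW.
  by rewrite -(spow0 r) mono.
by rewrite -lerN2 -!spowN mono ?lerN2 ?oppr_ge0// ltW.
Qed.

Lemma spow_ge0 r a : 0 < r -> 0 <= a -> 0 <= spow a r.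
Proof. by move=> r0 a0; rewrite spow_ge0E ?powR_ge0. Qed.

Lemma spowM r a b : 0 < r -> 0 <= a -> spow (a * b) r = a `^ r * spow b r.
Proof.
move=> r0 a0; have [b0|/ltW b0] := leP 0 b.
  by rewrite !spow_ge0E ?mulr_ge0// powRM.
rewrite -oppr_ge0 in b0; rewrite -[b]opprK; move: (- b) b0 => {}b b0.
by rewrite mulrN !spowN !spow_ge0E ?mulr_ge0// powRM// mulrN.
Qed.

Lemma mul_spow_norm p x : 1 < p -> spow x (p - 1) * x = `|x| `^ p.
Proof.
move=> p1; have p0 : 0 < p - 1 by lra.
have [x0|/ltW x0] := leP 0 x.
  by rewrite spow_ge0E// mulrC ger0_norm// mulr_powRB1//; lra.
rewrite -[x in LHS]opprK spowN mulrNN spow_ge0E ?oppr_ge0// mulrC ler0_norm//.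
by rewrite mulr_powRB1 ?oppr_ge0//; lra.
Qed.

(* Young's inequality is convexity of [|x|^p] in tangent line form. *)
Lemma spow_tangent p x y : 1 < p ->
  p * spow x (p - 1) * (y - x) <= `|y| `^ p - `|x| `^ p.
Proof.
move=> p1; have p0 : 0 < p by lra.
have r0 : 0 < p - 1 by lra.
have pN0 : p != 0 by rewrite gt_eqF.
have rN0 : p - 1 != 0 by rewrite gt_eqF.
have := @conjugate_powR R `|y| (`|x| `^ (p - 1)) p (p / (p - 1))
  (normr_ge0 _) (powR_ge0 _ _) p0 (divr_gt0 p0 r0).
have -> : p^-1 + (p / (p - 1))^-1 = 1 by field; apply/andP.
rewrite -powRrM (_ : (p - 1) * (p / (p - 1)) = p); last by field.
move=> /(_ erefl) young.
have le_norm : spow x (p - 1) * y <= `|y| * `|x| `^ (p - 1).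
  by rewrite -normr_spow// mulrC (le_trans (ler_norm _))// normrM.
have := ler_wpM2l (ltW p0) (le_trans le_norm young).
have -> : p * (`|y| `^ p / p + `|x| `^ p / (p / (p - 1))) =
   `|y| `^ p + (p - 1) * `|x| `^ p by field; apply/andP.
have := mul_spow_norm x p1.
set S := spow _ _; set A := `|x| `^ p; set B := `|y| `^ p => SA H.
have -> : p * S * (y - x) = p * (S * y) - p * (S * x) by ring.
rewrite SA; lra.
Qed.

Lemma powR_subadd r s t : 0 < r -> r <= 1 -> 0 <= s -> s <= t ->
  t `^ r <= s `^ r + (t - s) `^ r.
Proof.
move=> r0 r1 s0 st; have := le_trans s0 st; rewrite le_eqVlt => /predU1P[<-|t0].
  by rewrite powR0 ?gt_eqF// addr_ge0 ?powR_ge0.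
have le_pow x : 0 <= x -> x <= 1 -> x <= x `^ r.
  rewrite le_eqVlt => /predU1P[<- _|x0 x1]; first by rewrite powR_ge0.
  by rewrite ger1_powR// x0.
have x0 : 0 <= s / t by rewrite divr_ge0// ltW.
have x1 : s / t <= 1 by rewrite ler_pdivrMr// mul1r.
have -> : t - s = t * (1 - s / t) by field; rewrite gt_eqF.
have {1}-> : s = t * (s / t) by field; rewrite gt_eqF.
move: (s / t) x0 x1 => x x0 x1.
rewrite !powRM ?subr_ge0 ?(ltW t0)// -mulrDr ler_peMr ?powR_ge0//.
have := le_pow _ x0 x1; have := le_pow (1 - x); lra.
Qed.

Lemma spow_unif_continuous r e : 0 < r -> 0 < e ->
  exists2 eta, 0 < eta & forall a b, `|a| <= 1 -> `|b| <= 1 ->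
    `|a - b| <= eta -> `|spow a r - spow b r| <= e.
Proof.
move=> r0 e0; pose eta := Num.min ((e / 2) `^ r^-1) (e / r).
have eta0 : 0 < eta by rewrite lt_min powR_gt0 ?divr_gt0.
have eta_pow x : 0 <= x -> x <= eta -> x `^ r <= e / 2.
  move=> x0; rewrite le_min => /andP[xe _].
  have -> : e / 2 = ((e / 2) `^ r^-1) `^ r.
    by rewrite -powRrM mulVf ?lt0r_neq0// powRr1// divr_ge0// ltW.
  by rewrite ge0_ler_powR ?nnegrE ?powR_ge0 ?(ltW r0).
exists eta => //.
have same s t : 0 <= s -> s <= t -> t <= 1 -> t - s <= eta ->
    t `^ r - s `^ r <= e.
  move=> s0 st t1 ts; have [r1|r1] := leP r 1.
    have := powR_subadd r0 r1 s0 st; have := eta_pow (t - s); lra.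
  have := @spow_tangent r t s r1; have t0 := le_trans s0 st.
  rewrite !ger0_norm// spow_ge0E; [|lra|done] => tangent.
  have le1 : t `^ (r - 1) <= 1.
    have := @ge0_ler_powR _ (r - 1) _ t 1; rewrite !nnegrE powR1; apply=> //.
    lra.
  have : r * (t - s) <= e.
    move: ts; rewrite le_min => /andP[_]; rewrite ler_pdivlMr//; lra.
  have : r * t `^ (r - 1) * (t - s) <= r * (t - s).
    by rewrite ler_wpM2r ?subr_ge0// ler_piMr// ltW.
  lra.
have pos a b : 0 <= a -> b <= a -> `|a| <= 1 -> `|b| <= 1 -> `|a - b| <= eta ->
    `|spow a r - spow b r| <= e.
  move=> a0 ba; rewrite !ler_norml => /andP[? ?] /andP[? ?] /andP[? ?].
  have := ler_spow r0 ba;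
  move=> H; apply/andP; split; first by lra.
  have [b0|b0] := leP 0 b.
    by rewrite !spow_ge0E//; apply: same.
  rewrite -[b]opprK spowN !spow_ge0E//; last lra.
  have := eta_pow a; have := eta_pow (- b); lra.
have ord a b : b <= a -> `|a| <= 1 -> `|b| <= 1 -> `|a - b| <= eta ->
    `|spow a r - spow b r| <= e.
  move=> ba a1 b1 ab; have [a0|/ltW a0] := leP 0 a; first exact: pos.
  have := @pos (- b) (- a).
  rewrite !normrN !spowN !opprK ![- _ + _]addrC; apply=> //; lra.
move=> a b a1 b1 ab; have [ba|/ltW ba] := leP b a; first exact: ord.
by rewrite distrC ord// distrC.
Qed.

Lemma picone p a b s t : 1 < p -> 0 <= a -> 0 <= b -> 0 < s -> 0 < t ->
  spow (s - t) (p - 1) * (a `^ p / s `^ (p - 1) - b `^ p / t `^ (p - 1)) <=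
  `|a - b| `^ p.
Proof.
move=> p1; have r0 : 0 < p - 1 by lra.
have p0 : 0 < p by lra.
wlog ts : a b s t / t <= s => [H a0 b0 s0 t0|a0 b0 s0 t0].
  have [|/ltW st] := leP t s; first by move=> ?; exact: H.
  by rewrite -[s - t]opprB spowN mulNr -mulrN opprB distrC; apply: H.
have S0 : 0 < s `^ (p - 1) by rewrite powR_gt0.
have T0 : 0 < t `^ (p - 1) by rewrite powR_gt0.
move: ts; rewrite le_eqVlt => /predU1P[->|ts].
  by rewrite subrr spow0 mul0r powR_ge0.
have d0 : 0 < s - t by lra.
have D0 : 0 < (s - t) `^ (p - 1) by rewrite powR_gt0.
rewrite (spow_ge0E r0 (ltW d0)).
(* Convexity at [a = (1 - t/s) (a-b)/(1 - t/s) + (t/s) b/(t/s)]. *)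
have := @spow_tangent p a ((a - b) * (s / (s - t))) p1.
have := @spow_tangent p a (b * (s / t)) p1.
have powE x z : 0 <= x -> 0 < z -> (x * (s / z)) `^ p =
   x `^ p * (s * s `^ (p - 1) / (z * z `^ (p - 1))).
  move=> x0 z0; rewrite powRM// ?divr_ge0 ?ltW// powRM ?invr_ge0 ?ltW//.
  by rewrite -powR_inv1 ?ltW// powRAC powR_inv1 ?powR_ge0// !mulr_powRB1 ?ltW.
have d1 : 0 <= s / (s - t) by rewrite divr_ge0 ?ltW.
have t1 : 0 <= s / t by rewrite divr_ge0 ?ltW.
rewrite (normrM (a - b)) (ger0_norm d1) (ger0_norm (mulr_ge0 b0 t1)).
rewrite !powE// (ger0_norm a0).
set A := a `^ p; set B := b `^ p; set E := `|a - b| `^ p; set K := spow _ _.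
move: S0 T0 D0; set S := s `^ _; set T := t `^ _; set D := _ `^ (p - 1).
move=> S0 T0 D0 H1 H2.
have K1 : t / s * (p * K * (b * (s / t) - a)) +
   (1 - t / s) * (p * K * ((a - b) * (s / (s - t)) - a)) = 0.
  by field; rewrite !gt_eqF.
have H3 : 0 <= t / s * (B * (s * S / (t * T)) - A) +
   (1 - t / s) * (E * (s * S / ((s - t) * D)) - A).
  rewrite -K1; apply: lerD; apply: ler_wpM2l => //.
    by rewrite divr_ge0 ?ltW.
  by rewrite subr_ge0 ler_pdivrMr ?mul1r ?ltW.
have {}H3 : 0 <= D / S * (t / s * (B * (s * S / (t * T)) - A) +
   (1 - t / s) * (E * (s * S / ((s - t) * D)) - A)).
  by rewrite mulr_ge0// divr_ge0 ?ltW.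
rewrite -subr_ge0; move: H3; congr (0 <= _).
by field; rewrite !gt_eqF.
Qed.

(* The first-order term in [x - y] cancels, and what remains is controlled by
   the modulus of continuity [e] of the signed power. *)
Lemma cutoff_energy p a b x y eta e : 1 < p -> 0 <= a -> 0 <= b ->
  0 <= x <= 1 -> 0 <= y <= 1 -> `|x - y| <= eta -> 0 <= e ->
  (forall s t, `|s| <= 1 -> `|t| <= 1 -> `|s - t| <= eta ->
     `|spow s (p - 1) - spow t (p - 1)| <= e) ->
  `|x * a - y * b| `^ p -
    spow (a - b) (p - 1) * (x `^ p * a - y `^ p * b) <=
  p * Num.max a b `^ p * `|x - y| * e.
Proof.
move=> p1; have r0 : 0 < p - 1 by lra.
have p0 : 0 < p by lra.
wlog ba : a b x y / b <= a => [H a0 b0 x1 y1 xy e0 He|a0 b0 x1 y1 xy e0 He].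
  have /orP[ba|ab] := le_total b a; first exact: H.
  rewrite distrC in xy; have := H b a y x ab b0 a0 y1 x1 xy e0 He.
  rewrite maxC (distrC (y * b)) -[b - a]opprB spowN mulNr -mulrN opprB.
  by rewrite maxC (distrC y).
rewrite max_l//.
move: a0; rewrite le_eqVlt => /predU1P[a0|a0].
  have -> : b = 0 by lra.
  by rewrite -a0 !mulr0 !subrr normr0 !powR0 ?gt_eqF// !(mulr0, mul0r) subrr.
case/andP: x1 => x0 x1; case/andP: y1 => y0 y1.
pose c := (1 - b / a) * y.
have q0 : 0 <= b / a by rewrite divr_ge0// ltW.
have q1 : b / a <= 1 by rewrite ler_pdivrMr ?mul1r.
have c0 : 0 <= c by rewrite mulr_ge0// subr_ge0.
have c1 : c <= 1 by rewrite mulr_ile1 ?subr_ge0//; lra.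
have cx : c + (x - y) = x - b / a * y by rewrite /c; ring.
have by0 : 0 <= b / a * y by rewrite mulr_ge0.
have by1 : b / a * y <= 1 by rewrite mulr_ile1.
have -> : x * a - y * b = a * (c + (x - y)) by rewrite cx; field; rewrite gt_eqF.
rewrite spow_ge0E ?subr_ge0//.
have -> : (a - b) `^ (p - 1) = a `^ (p - 1) * (1 - b / a) `^ (p - 1).
  rewrite -powRM ?(ltW a0) ?subr_ge0//; congr (_ `^ _).
  by field; rewrite gt_eqF.
have -> : x `^ p * a - y `^ p * b = a * (x `^ p - b / a * y `^ p).
  by field; rewrite gt_eqF.
rewrite normrM powRM ?normr_ge0// (gtr0_norm a0).
have -> : a `^ (p - 1) * (1 - b / a) `^ (p - 1) * (a * (x `^ p - b / a * y `^ p))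
   = a `^ p * ((1 - b / a) `^ (p - 1) * (x `^ p - b / a * y `^ p)).
  by rewrite -[a `^ p]mulr_powRB1 ?ltW//; ring.
rewrite -mulrBr.
have -> : p * a `^ p * `|x - y| * e = a `^ p * (p * `|x - y| * e) by ring.
rewrite ler_wpM2l ?powR_ge0//.
have tx := @spow_tangent p y x p1; rewrite spow_ge0E// !ger0_norm// in tx.
have tc := @spow_tangent p (c + (x - y)) c p1.
have Hq : `|spow (c + (x - y)) (p - 1) - spow c (p - 1)| <= e.
  by apply: He; rewrite ?ler_norml ?cx; [lra|lra|move: xy; rewrite ler_norml /c; lra].
have Hd : (spow (c + (x - y)) (p - 1) - spow c (p - 1)) * (x - y) <= e * `|x - y|.
  by rewrite (le_trans (ler_norm _))// normrM ler_wpM2r.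
have cp : c `^ (p - 1) = (1 - b / a) `^ (p - 1) * y `^ (p - 1).
  by rewrite powRM ?subr_ge0.
have cpp : `|c| `^ p = (1 - b / a) * (1 - b / a) `^ (p - 1) * y `^ p.
  by rewrite ger0_norm// powRM ?subr_ge0// -mulr_powRB1 ?subr_ge0//.
rewrite cpp in tc; rewrite (spow_ge0E r0 c0) cp in Hd.
move: tx tc Hd; set Y := y `^ p; set X := x `^ p; set Q := (1 - b / a) `^ _.
set F := spow _ _; set G := y `^ (p - 1); set E := `|_| `^ p; set q := b / a.
move=> tx tc Hd.
have Q0 : 0 <= Q by rewrite powR_ge0.
have := ler_wpM2l Q0 tx; have := ler_wpM2l (ltW p0) Hd.
lra.
Qed.

End SignedPower.

Section Sequences.
Set Implicit Arguments.
Unset Strict Implicit.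

Lemma ler_sum_mem (R : realType) (T : eqType) (s : seq T) (P : pred T) (F : T -> R) x :
  x \in s -> P x -> (forall y, P y -> 0 <= F y) -> F x <= \sum_(y <- s | P y) F y.
Proof.
by move=> xs Px F0; rewrite (big_rem x)//= Px lerDl sumr_ge0.
Qed.

Lemma argmax_seq (R : realDomainType) (T : eqType) (s : seq T) (F : T -> R) x :
  x \in s -> exists2 z, z \in s & forall y, y \in s -> F y <= F z.
Proof.
elim: s x => // a s IH x _; case: s IH => [_|b s IH].
  by exists a; rewrite ?mem_head// => y; rewrite inE => /eqP ->.
have [z zs zmax] := IH b (mem_head _ _).
have /orP[az|za] := le_total (F a) (F z).
  exists z; first by rewrite inE zs orbT.
  by move=> y; rewrite inE => /predU1P[->//|]; exact: zmax.
exists a; rewrite ?mem_head// => y; rewrite inE => /predU1P[->//|/zmax yz].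
exact: le_trans yz za.
Qed.

End Sequences.

Section RegularTree.
Set Implicit Arguments.
Unset Strict Implicit.
Context {X : choiceType} (adj : rel X) (o : X) (d : nat).
Context (d0 : (0 < d)%N) (tree : is_regular_tree adj o d).
Implicit Types (x y : X) (n N : nat).

Local Notation h x := (gdist adj x o).

Let adjC : symmetric adj.
Proof. by case: tree => _ []. Qed.

Lemma gdist_walk x : (exists2 s, walk adj x o s & size s = h x) /\
  forall s, walk adj x o s -> (h x <= size s)%N.
Proof.
have [s0 ws0] : exists s, walk adj x o s by case: tree => _ [].
pose P n := `[< exists2 s, walk adj x o s & size s = n >].
have exP : exists n, P n by exists (size s0); apply/asboolP; exists s0.
case: (ex_minnP exP) => m /asboolP[s ws sm] minm.
have : [set n | (exists s, walk adj x o s /\ size s = n) /\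
    (forall s, walk adj x o s -> (n <= size s)%N)] (h x).
  apply: (@xgetI _ _ _ m); split; first by exists s.
  by move=> s' ws'; apply: minm; apply/asboolP; exists s'.
by case=> -[t [wt tE] H]; split => //; exists t.
Qed.

Lemma gdist_root : h o = 0%N.
Proof. by apply/eqP; rewrite -leqn0; apply: (proj2 (gdist_walk o) [::]). Qed.

Lemma gdist_adj x y : adj x y -> (h x <= (h y).+1)%N.
Proof.
move=> xy; have [[s [ps ls] <-] _] := gdist_walk y.
by apply: (proj2 (gdist_walk x) (y :: s)); split => //=; rewrite xy.
Qed.

Lemma gdist_parent x : x <> o -> exists2 y, adj x y & h x = (h y).+1.
Proof. by case: tree => _ _ _ H /H[y [[xy hxy] _]]; exists y. Qed.

Lemma children_seq x : exists s, [/\ uniq s, size s = d &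
  forall y, (y \in s) = adj x y && (h y == (h x).+1)].
Proof.
case: tree => _ _ /(_ x) card_children _.
have /finite_fsetP[A EA] : finite_set [set y | adj x y /\ h y = (h x).+1].
  by apply/finite_setP; exists d.
move: card_children; rewrite EA => /card_eq_fsetP cardA.
exists (enum_fset A); split; [exact: fset_uniq|exact: cardA|].
move=> y; apply/idP/andP => [yA|[xy /eqP hy]].
  have : [set` A] y by [].
  by rewrite -EA => -[-> ->].
have : [set y | adj x y /\ h y = (h x).+1] y by [].
by rewrite EA.
Qed.

Lemma sphere_seq n : exists s, [/\ uniq s, (size s <= d ^ n)%N &
  forall y, (y \in s) = (h y == n)].
Proof.
elim: n => [|n [s [us ss sE]]].
  exists [:: o]; split => // y; rewrite inE; apply/eqP/eqP => [->|hy].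
    exact: gdist_root.
  by apply: contrapT => /gdist_parent[z _]; rewrite hy.
have [c cP] := choice children_seq.
exists (undup (flatten (map c s))); split; first exact: undup_uniq.
  rewrite (leq_trans (size_undup _))// size_flatten /shape -map_comp.
  rewrite sumnE big_map (eq_bigr (fun=> d)).
    by rewrite big_const_seq count_predT iter_addn_0 expnS leq_mul.
  by move=> x _; case: (cP x).
move=> y; rewrite mem_undup; apply/flatten_mapP/eqP => [[x]|hy].
  by rewrite sE => /eqP xn; case: (cP x) => _ _ ->; rewrite xn => /andP[_ /eqP].
have /gdist_parent[x yx] : y <> o by move=> yo; move: hy; rewrite yo gdist_root.
rewrite hy => -[xn]; exists x; first by rewrite sE -xn.
by case: (cP x) => _ _ ->; rewrite adjC yx hy xn eqxx.
Qed.

Lemma ball_seq {R : realType} N : exists s, [/\ uniq s,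
  (forall y, (y \in s) = (h y <= N)%N) &
  \sum_(x <- s) d%:R ^- h x <= N.+1%:R :> R].
Proof.
elim: N => [|N [s [us sE ssum]]].
  have [s [us ss sE]] := sphere_seq 0; exists s; split => //.
    by move=> y; rewrite sE leqn0.
  rewrite (eq_big_seq (fun=> 1)); last first.
    by move=> x; rewrite sE => /eqP ->; rewrite invr1.
  by rewrite big_const_seq count_predT iter_addr_0 ler_nat.
have [t [ut st tE]] := sphere_seq N.+1; exists (s ++ t); split.
- rewrite cat_uniq us ut andbT; apply/hasPn => x; rewrite tE => /eqP hx.
  by rewrite /mem /= sE hx ltnn.
- by move=> y; rewrite mem_cat sE tE [RHS]leq_eqVlt orbC.
rewrite big_cat/= -[N.+2]addn1 natrD lerD//.
rewrite (eq_big_seq (fun=> d%:R ^- N.+1)); last by move=> x; rewrite tE => /eqP ->.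
rewrite big_const_seq count_predT iter_addr_0 -(mulr_natl _ (size t)).
rewrite ler_pdivrMr ?exprn_gt0 ?ltr0n// mul1r -natrX ler_nat//.
Qed.

Section Sums.
Context {R : realType} (N : nat) (s : seq X) (us : uniq s).
Context (sE : forall y, (y \in s) = (h y <= N)%N).

Lemma plaplacian_ball p (f : X -> R) x : (h x < N)%N ->
  plaplacian adj p f x = \sum_(y <- s | adj x y) spow (f x - f y) (p - 1).
Proof.
move=> hx; rewrite -big_filter [RHS]fsbig_seq ?filter_uniq//.
rewrite /plaplacian; congr (\big[_/_]_(y \in _) _).
apply/seteqP; split => y /=; rewrite mem_filter ?sE.
  by move=> xy; rewrite xy (leq_trans (@gdist_adj y x _))// adjC.
by move=> /andP[].
Qed.

Lemma sum_children_le x (M : R) : 0 <= M ->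
  \sum_(y <- s | adj x y) (if h y == (h x).+1 then M else 0) <= d%:R * M.
Proof.
move=> M0; rewrite -big_mkcondr big_const_seq iter_addr_0 -(mulr_natl M).
have [c [uc <- cE]] := children_seq x.
rewrite ler_wpM2r// ler_nat -size_filter uniq_leq_size ?filter_uniq// => y.
by rewrite mem_filter cE => /andP[].
Qed.

End Sums.

Lemma edge_sumC {R : nmodType} (s : seq X) (F : X -> X -> R) :
  \sum_(x <- s) \sum_(y <- s | adj x y) F x y =
  \sum_(x <- s) \sum_(y <- s | adj x y) F y x.
Proof.
rewrite (exchange_big_dep xpredT)//=; apply: eq_bigr => y _.
by apply: eq_bigl => x; rewrite adjC.
Qed.

Lemma summation_by_parts {R : realType} (s : seq X) (g : X -> R) (A : X -> X -> R) :
  (forall x y, A y x = - A x y) ->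
  2 * \sum_(x <- s) g x * (\sum_(y <- s | adj x y) A x y) =
  \sum_(x <- s) \sum_(y <- s | adj x y) A x y * (g x - g y).
Proof.
move=> AN; rewrite mulrDl mul1r.
under eq_bigr do rewrite mulr_sumr.
rewrite [in X in _ + X]edge_sumC -big_split; apply: eq_bigr => x _.
by rewrite -big_split; apply: eq_bigr => y _ /=; rewrite AN; ring.
Qed.

Lemma positive_everywhere {R : realType} (p : R) V (f : X -> R) x0 : 1 < p ->
  schrodinger_superharmonic adj p V f -> (forall x, 0 <= f x) ->
  f x0 <> 0 -> forall x, 0 < f x.
Proof.
move=> p1 sf f0 fx0 x; have r0 : 0 < p - 1 by lra.
rewrite lt_def f0 andbT; apply/eqP => fx; apply: fx0.
have step y z : adj y z -> f y = 0 -> f z = 0.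
  move=> yz fy; have [s [us sE _]] := @ball_seq R (h y).+1.
  have := sf y; rewrite /schrodinger fy spow0 mulr0 addr0.
  rewrite (plaplacian_ball us sE)// => sum0.
  have zs : z \in s by rewrite sE gdist_adj// adjC.
  have := @ler_sum_mem R X s (adj y) (fun t => spow (f t) (p - 1)) z zs yz.
  have E : \sum_(t <- s | adj y t) spow (f t) (p - 1) =
     - \sum_(t <- s | adj y t) spow (f y - f t) (p - 1).
    by rewrite -sumrN; apply: eq_bigr => t _; rewrite fy sub0r spowN opprK.
  move=> /(_ (fun t _ => spow_ge0 r0 (f0 t))); rewrite E => le0.
  apply/eqP; rewrite eq_le f0 andbT leNgt; apply/negP => fz.
  have : 0 < spow (f z) (p - 1) by rewrite spow_ge0E// powR_gt0.
  lra.
have [s [ps <-]] : exists s, walk adj x x0 s by case: tree => _ [].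
by elim: s x fx ps => //= y s IH x fx /andP[xy]; apply: IH; exact: step fx.
Qed.

Lemma schrodingerN {R : realType} (p : R) V (f : X -> R) x :
  schrodinger adj p V (fun y => - f y) x = - schrodinger adj p V f x.
Proof.
have [s [us sE _]] := @ball_seq R (h x).+1.
rewrite /schrodinger !(plaplacian_ball us sE)// spowN mulrN opprD; congr (_ + _).
by rewrite -sumrN; apply: eq_bigr => y _; rewrite -spowN !opprB addrC opprK.
Qed.

(* [c * beta ^+ |x|] solves [Delta_p v + v^<p-1> = 0] off the root, and it
   cannot exceed [u] at a maximum of the difference. *)
Lemma exp_lower_bound {R : realType} (p beta : R) V (u : X -> R) x :
  1 < p -> 0 < beta -> beta < 1 ->
  (1 - beta) `^ (p - 1) = d%:R^-1 * (beta^-1 - 1) `^ (p - 1) - d%:R^-1 ->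
  (forall x, V x <= 1) -> schrodinger_superharmonic adj p V u ->
  (forall x, 0 < u x) -> u o * beta ^+ h x <= u x.
Proof.
move=> p1 b0 b1 hb V1 su u0; rewrite leNgt; apply/negP => ux.
have r0 : 0 < p - 1 by lra.
pose c := u o; have c0 : 0 < c by exact: u0.
pose v y := c * beta ^+ h y.
have v0 y : 0 < v y by rewrite mulr_gt0// exprn_gt0.
pose e : R := v x - u x; have e0 : 0 < e by rewrite subr_gt0.
have [N0 _ HN0] : \forall n \near \oo, `|beta ^+ n| < e / c.
  have : beta ^+ n @[n --> \oo] --> 0 by apply: cvg_expr; rewrite gtr0_norm.
  by move/cvgr0Pnorm_lt; apply; rewrite divr_gt0.
pose N := maxn N0 (h x).
have [s [us sE _]] := @ball_seq R N.
have xs : x \in s by rewrite sE leq_maxr.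
have [z zs zmax] := argmax_seq (fun y => v y - u y) xs.
have {}zmax y : v y - u y <= v z - u z.
  have [/zmax//|yNs] := boolP (y \in s).
  rewrite (le_trans _ (zmax _ xs))//.
  rewrite sE -ltnNge in yNs.
  have : v y <= e.
    have /HN0 : (N0 <= h y)%N by rewrite (leq_trans (leq_maxl _ (h x)) (ltnW yNs)).
    by rewrite gtr0_norm ?exprn_gt0// ltr_pdivlMr// mulrC => /ltW.
  by have := u0 y; rewrite -/e; lra.
have uz : u z < v z by have := zmax x; rewrite -/e; lra.
have zo : z <> o.
  by move=> zo; move: uz; rewrite zo /v gdist_root expr0 mulr1 ltxx.
have [w zw hz] := gdist_parent zo.
have [t [ut tE _]] := @ball_seq R (h z).+1.
have Eb : (v z) `^ (p - 1) * d%:R * (1 - beta) `^ (p - 1) =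
    (v z) `^ (p - 1) * (beta^-1 - 1) `^ (p - 1) - (v z) `^ (p - 1).
  by rewrite hb; field; rewrite pnatr_eq0 -lt0n.
have := su z; rewrite /schrodinger (plaplacian_ball ut tE)//.
have Du : \sum_(y <- t | adj z y) spow (u z - u y) (p - 1) <=
          \sum_(y <- t | adj z y) spow (v z - v y) (p - 1).
  by apply: ler_sum => y _; apply: ler_spow => //; have := zmax y; lra.
have Vu : V z * spow (u z) (p - 1) < v z `^ (p - 1).
  rewrite spow_ge0E ?ltW// (@le_lt_trans _ _ (u z `^ (p - 1)))//.
    by rewrite ler_piMl// powR_ge0.
  by rewrite gt0_ltr_powR ?nnegrE ?ltW.
suff : \sum_(y <- t | adj z y) spow (v z - v y) (p - 1) <= - v z `^ (p - 1).
  lra.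
have wt : w \in t by rewrite tE hz -addn2 leq_addr.
rewrite (big_rem w)//= zw.
have -> : v z - v w = v z * - (beta^-1 - 1).
  by rewrite /v hz exprS; field; rewrite gt_eqF.
have bV : 0 <= beta^-1 - 1 by rewrite subr_ge0 invf_ge1 ?ltW.
rewrite spowM ?(ltW (v0 z))// spowN spow_ge0E// mulrN.
have rest : \sum_(y <- rem w t | adj z y) spow (v z - v y) (p - 1) <=
    d%:R * (v z `^ (p - 1) * (1 - beta) `^ (p - 1)).
  have M0 : 0 <= v z `^ (p - 1) * (1 - beta) `^ (p - 1).
    by rewrite mulr_ge0 ?powR_ge0.
  apply: le_trans (sum_children_le (rem_uniq _ ut) z M0).
  apply: ler_sum => y zy; case: eqP => hy.
    have -> : v z - v y = v z * (1 - beta) by rewrite /v hy exprS; ring.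
    by rewrite spowM ?(ltW (v0 z))// spow_ge0E// subr_ge0 ltW.
  rewrite -(spow0 (p - 1)) ler_spow// subr_le0 ler_wpM2l ?(ltW c0)//.
  apply: ler_wiXn2l; [exact: ltW|exact: ltW|].
  rewrite -ltnS ltn_neqAle gdist_adj ?andbT 1?adjC//.
  exact/eqP.
lra.
Qed.

Lemma positivity_propagates {R : realType} (p C : R) V (phi u : X -> R) x0 y0 :
  1 < p -> schrodinger_superharmonic adj p V phi -> (forall x, 0 < phi x) ->
  schrodinger_harmonic adj p V u ->
  (forall x, `|u x| <= C * d%:R `^ (- ((h x)%:R / p))) ->
  adj x0 y0 -> 0 < u x0 -> 0 < u y0.
Proof.
move=> p1 sphi phi0 hu uC xy0 ux0; rewrite ltNge; apply/negP => uy0.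
have r0 : 0 < p - 1 by lra.
have p0 : 0 < p by lra.
pose w x := Num.max (u x) 0.
have w0 x : 0 <= w x by rewrite le_max lexx orbT.
pose m x := C * d%:R `^ (- ((h x)%:R / p)).
have wm x : w x <= m x.
  by rewrite ge_max !(le_trans _ (uC x)) ?ler_norm.
have m0 x : 0 <= m x := le_trans (w0 x) (wm x).
have C0 : 0 <= C.
  have : 0 <= C * d%:R `^ (- ((h x0)%:R / p)) by exact: m0.
  by rewrite pmulr_lge0// powR_gt0// ltr0n.
have mp x : m x `^ p = C `^ p * d%:R ^- h x.
  rewrite powRM ?powR_ge0// -powRrM; congr (_ * _).
  have -> : - ((h x)%:R / p) * p = - (h x)%:R by field; rewrite gt_eqF.
  by rewrite powR_invn.
have m_le x y : (h x <= h y)%N -> m y <= m x.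
  move=> xy; rewrite ler_wpM2l// ler_powR ?ler1n//.
  by rewrite lerN2 ler_wpM2r ?invr_ge0 ?(ltW p0)// ler_nat.
pose kappa : R := 1 - spow (1 - phi y0 / phi x0) (p - 1).
have kappa0 : 0 < kappa.
  have q0 : 0 < phi y0 / phi x0 by rewrite divr_gt0.
  have [q1|q1] := leP 0 (1 - phi y0 / phi x0); last first.
    have := ler_spow r0 (ltW q1); rewrite spow0 /kappa; lra.
  rewrite subr_gt0 spow_ge0E//.
  apply: (@lt_le_trans _ _ (1 `^ (p - 1))); last by rewrite powR1.
  by rewrite gt0_ltr_powR ?nnegrE//; lra.
pose delta : R := kappa * (2^-1 * w x0) `^ p.
have delta0 : 0 < delta.
  by rewrite mulr_gt0// powR_gt0// mulr_gt0 ?invr_gt0// (lt_le_trans ux0)// le_max lexx.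
pose K : R := 4 * d%:R * (p * C `^ p).
have K0 : 0 <= K.
  by rewrite mulr_ge0 ?mulr_ge0 ?powR_ge0 ?(ltW p0).
pose e : R := delta / (K + 1).
have e0 : 0 < e by rewrite divr_gt0//; lra.
suff : delta <= K * e.
  have : (K + 1) * e = delta by rewrite /e mulrC divfK// gt_eqF//; lra.
  lra.
move: e e0 => {}e e0.
have [eta eta0 He] := spow_unif_continuous r0 e0.
pose N := (Num.truncn eta^-1 + h x0 * 2).+2.
have N0 : 0 < N%:R :> R by rewrite ltr0n.
have Neta : N%:R^-1 <= eta.
  rewrite -[leRHS]invrK lef_pV2 ?posrE ?invr_gt0//.
  rewrite (le_trans (ltW (truncnS_gt _)))// ler_nat.
  by rewrite /N ltnW// !ltnS leq_addr.
have hxN : (h x0 < N)%N.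
  rewrite /N !ltnS (leq_trans _ (leqnSn _))// (leq_trans _ (leq_addl _ _))//.
  exact: leq_pmulr.
pose psi x : R := (N - h x)%N%:R / N%:R.
have psi01 x : 0 <= psi x <= 1.
  by rewrite divr_ge0//= ler_pdivrMr// mul1r ler_nat leq_subr.
have psi0 x : 0 <= psi x by case/andP: (psi01 x).
have psi_far x : (N <= h x)%N -> psi x = 0.
  by rewrite -subn_eq0 /psi => /eqP ->; rewrite mul0r.
have dpsi x y : adj x y -> `|psi x - psi y| <= N%:R^-1.
  move=> xy; have hxy := gdist_adj xy; rewrite adjC in xy.
  have hyx := gdist_adj xy.
  rewrite -mulrBl normrM (@gtr0_norm _ N%:R^-1) ?invr_gt0// ler_piMl ?invr_ge0//.
  rewrite ler_norml.
  have H1 : (N - h x <= 1 + (N - h y))%N by move: hxy hyx; clear; lia.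
  have H2 : (N - h y <= 1 + (N - h x))%N by move: hxy hyx; clear; lia.
  move: H1 H2; rewrite -!(ler_nat R) !natrD; lra.
have psi_half : 2^-1 <= psi x0.
  rewrite ler_pdivlMr// mulrC ler_pdivrMr// -natrM ler_nat /N; clear; lia.
pose f x := psi x * w x.
have f0 x : 0 <= f x by rewrite mulr_ge0.
pose q x := f x `^ p / phi x `^ (p - 1).
pose g x := psi x `^ p * w x.
have [s [us sE ssum]] := @ball_seq R N.
have test x : x \in s ->
    g x * (\sum_(y <- s | adj x y) spow (w x - w y) (p - 1)) <=
    q x * (\sum_(y <- s | adj x y) spow (phi x - phi y) (p - 1)).
  move=> xs; have [|xN] := leqP N (h x).
    by move=> /psi_far pE; rewrite /g /q /f pE mul0r powR0 ?gt_eqF// !mul0r.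
  have [ux|ux] := leP (u x) 0.
    by rewrite /g /q /f /w max_r// !mulr0 powR0 ?gt_eqF// !mul0r.
  have wx : w x = u x by rewrite /w max_l// ltW.
  have Dw : \sum_(y <- s | adj x y) spow (w x - w y) (p - 1) <=
      - (V x * u x `^ (p - 1)).
    have := hu x; rewrite /schrodinger (plaplacian_ball us sE)//.
    rewrite spow_ge0E ?(ltW ux)// => /eqP; rewrite addr_eq0 => /eqP <-.
    by apply: ler_sum => y _; rewrite ler_spow// wx lerD2l lerN2 le_max lexx.
  have Dphi : - (V x * phi x `^ (p - 1)) <=
      \sum_(y <- s | adj x y) spow (phi x - phi y) (p - 1).
    have := sphi x; rewrite /schrodinger (plaplacian_ball us sE)//.
    by rewrite spow_ge0E ?(ltW (phi0 x))// -lerBlDr sub0r.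
  have g0 : 0 <= g x by rewrite mulr_ge0 ?powR_ge0.
  have q0 : 0 <= q x by rewrite divr_ge0 ?powR_ge0.
  apply: le_trans (ler_wpM2l g0 Dw) _; apply: le_trans (ler_wpM2l q0 Dphi).
  rewrite /g /q /f wx powRM ?(ltW ux)// -(mulr_powRB1 (ltW ux) p0).
  rewrite le_eqVlt; apply/orP; left; apply/eqP; field.
  by rewrite gt_eqF// powR_gt0.
pose P x y := spow (phi x - phi y) (p - 1) * (q x - q y).
pose Q x y := spow (w x - w y) (p - 1) * (g x - g y).
pose F x y := `|f x - f y| `^ p.
pose Sum (G : X -> X -> R) := \sum_(x <- s) \sum_(y <- s | adj x y) G x y.
have SumB G1 G2 : Sum (fun x y => G1 x y - G2 x y) = Sum G1 - Sum G2.
  by rewrite /Sum -sumrB; apply: eq_bigr => x _; rewrite -sumrB.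
have QP : Sum Q <= Sum P.
  rewrite /Sum -!summation_by_parts; try by move=> x y; rewrite -spowN opprB.
  by rewrite ler_wpM2l// big_seq [leRHS]big_seq; exact: ler_sum.
have PF x y : P x y <= F x y by exact: picone.
have gap : delta <= F x0 y0 - P x0 y0.
  have wy0 : w y0 = 0 by rewrite /w max_r.
  rewrite /F /P /q /f wy0 !mulr0 subr0 powR0 ?gt_eqF// mul0r subr0.
  rewrite ger0_norm ?mulr_ge0//.
  have -> : phi x0 - phi y0 = phi x0 * (1 - phi y0 / phi x0).
    by field; rewrite gt_eqF.
  rewrite spowM ?(ltW (phi0 _))//.
  set A := (psi x0 * w x0) `^ p; set B := phi x0 `^ _.
  have -> : A - B * spow (1 - phi y0 / phi x0) (p - 1) * (A / B) = kappa * A.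
    by rewrite /kappa; field; rewrite gt_eqF// powR_gt0.
  rewrite ler_wpM2l ?(ltW kappa0)// ge0_ler_powR ?nnegrE ?(ltW p0) ?mulr_ge0//.
  by rewrite ler_wpM2r.
pose M x := p * m x `^ p * N%:R^-1 * e.
have M0 x : 0 <= M x.
  by rewrite !mulr_ge0 ?powR_ge0 ?invr_ge0 ?(ltW p0) ?(ltW e0) ?ler0n.
pose E x y : R := if h y == (h x).+1 then M x else 0.
have E0 x y : 0 <= E x y by rewrite /E; case: ifP.
have FQ x y : adj x y -> F x y - Q x y <= E x y + E y x.
  move=> xy; apply: (@le_trans _ _ (p * Num.max (w x) (w y) `^ p *
                                     `|psi x - psi y| * e)).
    apply: (cutoff_energy p1 _ _ _ _ _ (ltW e0) He) => //.
    exact: le_trans (dpsi _ _ xy) Neta.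
  have main a b : adj a b -> (h a < h b)%N ->
      p * Num.max (w a) (w b) `^ p * `|psi a - psi b| * e <= E a b + E b a.
    move=> ab hab; apply: (@le_trans _ _ (E a b)); last by rewrite lerDl.
    have -> : E a b = M a.
      rewrite /E ifT// eqn_leq hab andbT gdist_adj// adjC//.
    rewrite /M ler_wpM2r ?(ltW e0)//; apply: ler_pM => //.
    - by rewrite mulr_ge0 ?powR_ge0 ?(ltW p0).
    - rewrite ler_wpM2l ?(ltW p0)// ge0_ler_powR ?nnegrE ?(ltW p0)//.
        by rewrite le_max w0.
      by rewrite ge_max wm (le_trans (wm b)) ?m_le// ltnW.
    - exact: dpsi.
  have [hxy|hxy|hxy] := ltngtP (h x) (h y); first exact: main.
    by rewrite maxC distrC [leRHS]addrC main// adjC.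
  by rewrite /psi hxy subrr normr0 mulr0 mul0r addr_ge0.
have Esum : Sum E <= 2 * d%:R * (p * C `^ p) * e.
  apply: (@le_trans _ _ (\sum_(x <- s) d%:R * M x)).
    by apply: ler_sum => x _; exact: sum_children_le.
  have -> : \sum_(x <- s) d%:R * M x =
      d%:R * (p * C `^ p) * e / N%:R * \sum_(x <- s) d%:R ^- h x.
    by rewrite mulr_sumr; apply: eq_bigr => x _; rewrite /M mp; ring.
  have c0 : 0 <= d%:R * (p * C `^ p) * e.
    by rewrite !mulr_ge0 ?powR_ge0 ?(ltW p0) ?(ltW e0).
  apply: le_trans (ler_wpM2l _ ssum) _; first by rewrite divr_ge0 ?(ltW N0).
  have -> : 2 * d%:R * (p * C `^ p) * e = d%:R * (p * C `^ p) * e * 2 by ring.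
  rewrite -[_ / _ * _]mulrA ler_wpM2l// mulrC ler_pdivrMr// -natrM.
  by rewrite ler_nat /N; clear; lia.
have x0s : x0 \in s by rewrite sE ltnW.
have y0s : y0 \in s.
  by rewrite sE (leq_trans (@gdist_adj y0 x0 _))// adjC.
have FP0 x y : 0 <= F x y - P x y by rewrite subr_ge0.
have gapS : delta <= Sum (fun x y => F x y - P x y).
  apply: le_trans gap _.
  apply: (@le_trans _ _ (\sum_(y <- s | adj x0 y) (F x0 y - P x0 y))).
    exact: (ler_sum_mem (F := fun y => F x0 y - P x0 y)).
  apply: (ler_sum_mem (F := fun x => \sum_(y <- s | adj x y) (F x y - P x y))) => //.
  by move=> x _; rewrite sumr_ge0.
have FQS : Sum (fun x y => F x y - Q x y) <= Sum (fun x y => E x y + E y x).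
  by apply: ler_sum => x _; apply: ler_sum => y; exact: FQ.
have EE : Sum (fun x y => E x y + E y x) = Sum E + Sum E.
  rewrite /Sum [in X in _ = _ + X]edge_sumC -big_split.
  by apply: eq_bigr => x _; rewrite -big_split.
rewrite !SumB in gapS FQS; rewrite EE in FQS.
rewrite /K; lra.
Qed.

End RegularTree.

Theorem theorem4p5 (R : realType) (X : choiceType) (adj : rel X) (o : X)
    (d : nat) (p beta : R) (V u : X -> R)
    (hp : 1 < p) (hd : (2 <= d)%N)
    (htree : is_regular_tree adj o d)
    (hpos : positive_schrodinger adj p V)
    (hV : forall x, V x <= 1)
    (hbeta0 : 0 < beta) (hbeta1 : beta < 1)
    (hbeta : (1 - beta) `^ (p - 1) =
       d%:R^-1 * (beta^-1 - 1) `^ (p - 1) - d%:R^-1)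
    (hu : schrodinger_harmonic adj p V u)
    (hO : exists2 C : R, 0 <= C &
       forall x, `|u x| <= C * d%:R `^ (- ((gdist adj x o)%:R / p)))
    (hgrad_ge2 : 2 <= p -> exists2 C : R, 0 <= C &
       forall x y, adj x y ->
         `|grad (u^\+) x y| <= C * d%:R `^ (- ((gdist adj x o)%:R / p)))
    (hgrad_lt2 : p < 2 -> exists2 C : R, 0 <= C &
       forall x y, adj x y ->
         d%:R `^ (- ((gdist adj x o)%:R / p)) <= C * `|grad (u^\+) x y|)
    (hliminf : liminf_infty
       (fun x => (`|u x| / beta ^+ gdist adj x o)%:E) = 0%E) :
  forall x, u x = 0.
Proof.
have d0 : (0 < d)%N := ltnW hd.
have [C _ uC] := hO.
have [phi [sphi phi_ge0 [z phiz]]] := hpos.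
have phi0 := positive_everywhere d0 htree hp sphi phi_ge0 phiz.
have no_positive v : schrodinger_superharmonic adj p V v ->
    (forall x, `|u x| = v x) -> ~ (forall x, 0 < v x).
  move=> sv uv v0.
  have : ((v o)%:E <= 0)%E.
    rewrite -hliminf /liminf_infty; apply: le_trans (ereal_sup_ubound _); last first.
      by exists setT => //; rewrite /= setCT; exact: finite_set0.
    apply: le_ereal_inf_tmp => _ [x _ <-]; rewrite lee_fin uv.
    rewrite ler_pdivlMr ?exprn_gt0//.
    exact: (exp_lower_bound d0 htree x hp hbeta0 hbeta1 hbeta hV sv v0).
  by rewrite lee_fin leNgt v0.
have [[x1 ux1]|nex] := pselect (exists x, 0 < u x).
  have u0 x : 0 < u x.
    have [s [ps <-]] : exists s, walk adj x1 x s by case: htree => _ [].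
    elim: s x1 ux1 ps => //= y s IH x1 ux1 /andP[xy]; apply: IH.
    exact: (positivity_propagates d0 htree hp sphi phi0 hu uC xy ux1).
  exfalso; apply: (no_positive u) => // x; first by rewrite hu.
  by rewrite gtr0_norm.
have u_le0 x : u x <= 0.
  by rewrite leNgt; apply/negP => ux; apply: nex; exists x.
have sv : schrodinger_superharmonic adj p V (fun x => - u x).
  by move=> x; rewrite (schrodingerN d0 htree) hu oppr0.
move=> x; apply: contrapT => ux.
apply: (no_positive (fun x => - u x)) => //; first by move=> y; rewrite ler0_norm.
apply: (positive_everywhere d0 htree hp sv (x0 := x)) => [y|].
  by rewrite oppr_ge0.
by move/eqP; rewrite oppr_eq0 => /eqP.
Qed.
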